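(* Let $(G,D(\Delta))$ be a Garside system with $D(\Delta)$ finite, so that $G$ is a Garside group. Then: (g) every standard parabolic subgroup of $G$ is a Garside subgroup of $G$; (h) the intersection of two standard parabolic subgroups of $G$ is a standard parabolic subgroup of $G$.
   Context: Divisibility. In a monoid $M$, $g$ left-divides $h$ (written $g\prec h$) if $h=gk$ for some $k\in M$, and $g$ right-divides $h$ (written $h\succ g$) if $h=kg$ for some $k\in M$. $L(h)$ and $R(h)$ denote the sets of left-divisors and right-divisors of $h$. $M$ is cancellative if $ghk=gh'k$ implies $h=h'$; $M$ is Noetherian if for every $g\in M$ the set $\{k\in\mathbb N\mid g=g_1\cdots g_k,\ g_i\in M,\ g_i\neq 1\}$ is finite. $\Delta\in M$ is balanced if $L(\Delta)=R(\Delta)$; this common set is then denoted $D(\Delta)$. An atom of $M$ is an element $h\neq1$ such that $h=gk$ implies $g=1$ or $k=1$. Garside systems. A pair $(G^+,X)$, with $G^+$ a monoid and $X\subset G^+$, is a positive Garside system if: $G^+$ is Noetherian and cancellative; $G^+$ is a lattice for $\prec$ and a lattice for $\succ$; $X$ generates $G^+$ and $X=D(\Delta)$ for some balanced $\Delta\in G^+$ (the Garside element). $G^+$ is then a quasi-Garside monoid, and a Garside monoid if $D(\Delta)$ is finite. For a group $G$ and $X\subset G$, let $G^+$ be the submonoid of $G$ generated by $X$; $(G,X)$ is a Garside system if $(G^+,X)$ is a positive Garside system and $G$ is the group of fractions of $G^+$. $G$ is then a quasi-Garside group, and a Garside group if $G^+$ is a Garside monoid. The g.c.d. and l.c.m.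 of $g,h$ are denoted $g\land_L h$, $g\lor_L h$ for $\prec$ and $g\land_R h$, $g\lor_R h$ for $\succ$. Put $\alpha_L(w)=w\land_L\Delta$ and $\alpha_R(w)=w\land_R\Delta$ for $w\in G^+$. Garside subgroups. A submonoid $H^+$ of $G^+$ is a Garside submonoid if (1) $H^+$ is a sublattice of $G^+$ for left-divisibility and for right-divisibility (closed under $\land_L,\lor_L$ and under $\land_R,\lor_R$, computed in $G^+$), and (2) $\alpha_L(H^+)\subset H^+$ and $\alpha_R(H^+)\subset H^+$. A subgroup $H$ of $G$ is a Garside subgroup if $H\cap G^+$ is a Garside submonoid of $G^+$ and generates $H$. Standard parabolic subgroups. Let $S$ be the set of atoms of $G^+$. For a balanced element $\delta$ of $G^+$ with $\delta\in D(\Delta)$, put $\mathrm{supp}(\delta)=D(\delta)\cap S$, let $G_\delta$ be the subgroup of $G$ generated by $\mathrm{supp}(\delta)$, and $G^+_\delta=G_\delta\cap G^+$. $G_\delta$ is called a standard parabolic subgroup of $G$ if $D(\delta)=D(\Delta)\cap G^+_\delta$; the standard parabolic subgroups of $G$ are the subgroups obtained this way. *)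

(* Defs.v *)
From HB Require Import structures.
From mathcomp Require Import all_boot.
From mathcomp Require Import all_classical.

Set Implicit Arguments.
Unset Strict Implicit.
Unset Printing Implicit Defensive.

Local Open Scope classical_set_scope.
Local Open Scope group_scope.

Section Lattices.
Context {T : choiceType} (A : set T) (le : T -> T -> Prop).

Definition partial_order_on : Prop :=
  [/\ forall x, A x -> le x x,
      forall x y, A x -> A y -> le x y -> le y x -> x = y
    & forall x y z, A x -> A y -> A z -> le x y -> le y z -> le x z].

Definition is_glb (x y d : T) : Prop :=
  [/\ A d, le d x, le d y & forall e, A e -> le e x -> le e y -> le e d].

Definition is_lub (x y m : T) : Prop :=
  [/\ A m, le x m, le y m & forall e, A e -> le x e -> le y e -> le m e].

Definition lattice_on : Prop :=
  [/\ partial_order_on,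
      forall x y, A x -> A y -> exists d, is_glb x y d
    & forall x y, A x -> A y -> exists m, is_lub x y m].

End Lattices.

(* A monoid is represented as a submonoid M of an ambient monoidType T, so that
   the same definitions apply to a submonoid of a group; taking M := setT gives
   the notions for T itself.  All quotients and bounds are required to be in M. *)
Section Monoids.
Context {T : monoidType}.
Implicit Types (A M H X : set T) (g h d Delta : T).

Definition submonoid A : Prop := monoid_closed (mem A).

Definition generated_submonoid X : set T := smallest submonoid X.

Definition ldivides M g h : Prop := exists2 k, M k & h = g * k.
Definition rdivides M g h : Prop := exists2 k, M k & h = k * g.

Definition left_divisors M h : set T := [set g | M g /\ ldivides M g h].
Definition right_divisors M h : set T := [set g | M g /\ rdivides M g h].

Definition balanced M d : Prop :=
  M d /\ left_divisors M d = right_divisors M d.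

(* Only meaningful for a balanced d, where it is also [right_divisors M d]. *)
Definition divisors_of M d : set T := left_divisors M d.

Definition cancellative M : Prop :=
  forall g h h' k, M g -> M h -> M h' -> M k ->
    g * h * k = g * h' * k -> h = h'.

Definition noetherian M : Prop :=
  forall g, M g ->
    finite_set [set k : nat | exists s : seq T,
      [/\ size s = k, (forall x, x \in s -> M x /\ x <> 1)
        & g = \prod_(x <- s) x]].

Definition atoms M : set T :=
  [set h | [/\ M h, h <> 1
    & forall g k, M g -> M k -> h = g * k -> g = 1 \/ k = 1]].

(* The default value 1 is never used when M is a lattice for divisibility, in
   which case the bound exists and is unique. *)
Definition gcdL M g h : T := xget 1 [set d | is_glb M (ldivides M) g h d].
Definition lcmL M g h : T := xget 1 [set m | is_lub M (ldivides M) g h m].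
Definition gcdR M g h : T := xget 1 [set d | is_glb M (rdivides M) g h d].
Definition lcmR M g h : T := xget 1 [set m | is_lub M (rdivides M) g h m].

Definition alphaL M Delta w : T := gcdL M w Delta.
Definition alphaR M Delta w : T := gcdR M w Delta.

Definition garside_element M X Delta : Prop :=
  balanced M Delta /\ X = divisors_of M Delta.

Record positive_garside_system M X : Prop := PositiveGarsideSystem {
  pgs_submonoid : submonoid M;
  pgs_noetherian : noetherian M;
  pgs_cancellative : cancellative M;
  pgs_latticeL : lattice_on M (ldivides M);
  pgs_latticeR : lattice_on M (rdivides M);
  pgs_generated : generated_submonoid X = M;
  pgs_garside_element : exists Delta, garside_element M X Delta }.

Definition closed2 H (op : T -> T -> T) : Prop :=
  forall g h, H g -> H h -> H (op g h).

Record garside_submonoid M Delta H : Prop := GarsideSubmonoid {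
  gsm_submonoid : submonoid H;
  gsm_sub : H `<=` M;
  gsm_gcdL : closed2 H (gcdL M);
  gsm_lcmL : closed2 H (lcmL M);
  gsm_gcdR : closed2 H (gcdR M);
  gsm_lcmR : closed2 H (lcmR M);
  gsm_alphaL : alphaL M Delta @` H `<=` H;
  gsm_alphaR : alphaR M Delta @` H `<=` H }.

End Monoids.

Section Groups.
Context {G : groupType}.
Implicit Types (M H P X : set G) (d Delta : G).

Definition subgroup H : Prop := group_closed (mem H).

Definition generated_subgroup X : set G := smallest subgroup X.

(* For a submonoid M in which any two elements have common multiples on both
   sides, it is equivalent to ask for fractions a * b^-1. *)
Definition group_of_fractions M : Prop :=
  forall g : G, exists a b, [/\ M a, M b & g = a^-1 * b].

(* The monoid G^+ is [generated_submonoid X]. *)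
Definition garside_system X : Prop :=
  positive_garside_system (generated_submonoid X) X /\
  group_of_fractions (generated_submonoid X).

Definition garside_subgroup M Delta H : Prop :=
  [/\ subgroup H, garside_submonoid M Delta (H `&` M)
    & generated_subgroup (H `&` M) = H].

Definition supp M d : set G := divisors_of M d `&` atoms M.

Definition parabolic_group M d : set G := generated_subgroup (supp M d).

Definition parabolic_monoid M d : set G := parabolic_group M d `&` M.

Definition standard_parabolic M Delta P : Prop :=
  exists d, [/\ balanced M d, divisors_of M Delta d,
    divisors_of M d = divisors_of M Delta `&` parabolic_monoid M d
    & P = parabolic_group M d].

End Groups.

(* Main.v *)
Require Import Defs.
From mathcomp Require Import all_boot all_classical.
Local Open Scope classical_set_scope.

(** Write [M] for the positive monoid, [D d] for the divisors of a balanced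
    element [d] of [D Delta] with [D d = D Delta /\ G_d], and [N] for the
    submonoid generated by [D d].  Everything follows from the fact that [N] is
    closed under factors: if [g * k] lies in [N] with [g] and [k] in [M], then
    both lie in [N] ([generated_divisors_factor_closed]).

    To see this, let [x] be a divisor of [Delta] that left-divides
    [s * h], with [s] in [D d] and [h] in [N].  The least common multiple
    [m = s * y] of [x] and [s] divides [Delta], so [y] divides [Delta] and
    left-divides [h]; by induction on the length of the word, [y] is in [D d]
    and [h] is [y] times an element of [N].  Now [m = s * y] is in [N] and
    divides [Delta], so the hypothesis on [d] puts [m], and with it [x], in
    [D d] ([simple_divisor]).  As the divisors of [Delta] generate [M],
    removing them one at a time from the left of [g] gives the closure.

    As [d] is balanced, it is a common multiple of its divisors on both sides,
    with quotients in [D d] again, and common multiples propagate from [D d] to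
    [N] ([common_multiples]).  Hence [G_d] consists of the fractions [a * b^-1] with
    [a] and [b] in [N]; if such a fraction [g] is in [M], then [a = g * b] shows
    that it is in [N].  So [G_d /\ M = N].  A factor-closed submonoid with
    common multiples on both sides is a Garside submonoid: a gcd is a factor of
    each of its arguments, and an lcm is a factor of any common multiple.  This
    is the first claim.

    For the second claim, the left gcd [e] of [d] and [d'] is balanced, with
    [D e = D d /\ D d'] ([balanced_meet]), and its divisors are products of
    atoms of [D e], hence lie in [G_e].  By factor-closure, a positive
    element of both [G_d] and [G_d'] is a product of elements of
    [D Delta /\ G_d /\ G_d' = D e].  For an arbitrary
    [g = a * b^-1 = a' * b'^-1], left translation by [g] carries
    the gcd of [b] and [b'] to the gcd of [a] and [a'] ([gcdL_fraction]), and
    these two gcds are positive elements of both subgroups. *)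

Set Implicit Arguments.
Unset Strict Implicit.
Unset Printing Implicit Defensive.

(** * Submonoids and subgroups generated by a set *)

Section Generated.
Local Open Scope group_scope.

Lemma submonoidP (T : monoidType) (A : set T) :
  submonoid A <-> A 1 /\ forall x y, A x -> A y -> A (x * y).
Proof.
split=> [[/set_mem A1 AM]|[A1 AM]]; split=> //.
- by move=> x y Ax Ay; apply/set_mem/AM; apply/mem_set.
- exact/mem_set.
- by move=> x y /set_mem Ax /set_mem Ay; apply/mem_set/AM.
Qed.

Lemma subgroupP (G : groupType) (A : set G) :
  subgroup A <-> A 1 /\ forall x y, A x -> A y -> A (x * y^-1).
Proof.
split=> [[/set_mem A1 AM]|[A1 AM]]; split=> //.
- by move=> x y Ax Ay; apply/set_mem/AM; apply/mem_set.
- exact/mem_set.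
- by move=> x y /set_mem Ax /set_mem Ay; apply/mem_set/AM.
Qed.

Lemma subgroup_submonoid (G : groupType) (A : set G) :
  subgroup A -> submonoid A.
Proof.
move=> /subgroupP[A1 AV]; apply/submonoidP; split=> // x y Ax Ay.
have AyV : A y^-1 by rewrite -[y^-1]mul1g; exact: AV.
by rewrite -[y]invgK; exact: AV.
Qed.

Lemma submonoidI (T : monoidType) (A B : set T) :
  submonoid A -> submonoid B -> submonoid (A `&` B).
Proof.
move=> /submonoidP[A1 AM] /submonoidP[B1 BM]; apply/submonoidP; split=> //.
by move=> x y [Ax Bx] [Ay By]; split; [exact: AM|exact: BM].
Qed.

Lemma subgroupI (G : groupType) (A B : set G) :
  subgroup A -> subgroup B -> subgroup (A `&` B).
Proof.
move=> /subgroupP[A1 AM] /subgroupP[B1 BM]; apply/subgroupP; split=> //.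
by move=> x y [Ax Bx] [Ay By]; split; [exact: AM|exact: BM].
Qed.

Lemma generated_submonoidP (T : monoidType) (D : set T) :
  submonoid (generated_submonoid D).
Proof.
apply/submonoidP; split=> [A [/submonoidP[A1 _] _] //|x y Dx Dy A AD].
by case: (AD) => /submonoidP[_ AM] _; apply: AM; [exact: Dx|exact: Dy].
Qed.

Lemma generated_subgroupP (G : groupType) (D : set G) :
  subgroup (generated_subgroup D).
Proof.
apply/subgroupP; split=> [A [/subgroupP[A1 _] _] //|x y Dx Dy A AD].
by case: (AD) => /subgroupP[_ AM] _; apply: AM; [exact: Dx|exact: Dy].
Qed.

(** The generated submonoid is defined as an intersection; this recovers
    induction on words, whose letters are read from the left. *)
Lemma generated_left_ind (T : monoidType) (D P : set T) :
  P 1 ->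
  (forall s h, D s -> generated_submonoid D h -> P h -> P (s * h)) ->
  generated_submonoid D `<=` P.
Proof.
move=> P1 PM h Dh; have /submonoidP[N1 NM] := generated_submonoidP D.
pose K : set T := [set h | generated_submonoid D h /\
  forall k, generated_submonoid D k -> P k -> P (h * k)].
suff /(_ h Dh)[_ /(_ 1 N1 P1)] : generated_submonoid D `<=` K by rewrite mulg1.
apply: smallest_sub.
- apply/submonoidP; split; first by split=> // k _; rewrite mul1g.
  move=> x y [Nx Px] [Ny Py]; split=> [|k Nk Pk]; first exact: NM.
  by rewrite -mulgA; apply: Px; [exact: NM|exact: Py].
- by move=> s Ds; split=> [|k Nk Pk]; [exact: sub_gen_smallest|exact: PM].
Qed.

(** Filling a grid with squares: from common multiples of generators to common
    multiples of words, first for a generator against a word, then for two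
    words.  The product is an arbitrary [op] so that the lemma applies both to a
    multiplication and to the opposite one; this is also why [N] is described by
    an induction principle that does not favour a side.  In the first step the
    multiplier [b] of the word must again be a generator, otherwise the
    induction on the word does not go through. *)
Lemma common_multiples (T : Type) (e : T) (op : T -> T -> T) (D N : set T) :
  associative op -> left_id e op -> right_id e op ->
  N e -> (forall x y, N x -> N y -> N (op x y)) -> D `<=` N ->
  (forall P : set T, P e -> (forall x y, P x -> P y -> P (op x y)) ->
     D `<=` P -> N `<=` P) ->
  (forall s t, D s -> D t -> exists x y, [/\ D x, D y & op s x = op t y]) ->
  forall g h, N g -> N h -> exists u v, [/\ N u, N v & op g u = op h v].
Proof.
move=> opA op1x opx1 N1 NM DN Nind square.
pose P1 : set T := [set h | forall s, D s ->
  exists x b, [/\ N x, D b & op s x = op h b]].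
have NP1 : N `<=` P1.
  apply: Nind.
  - by move=> s Ds; exists e, s; rewrite opx1 op1x.
  - move=> h k Ph Pk s /Ph[x [b [Nx Db sx]]].
    have [y [c [Ny Dc Eb]]] := Pk b Db.
    by exists (op x y), c; split; rewrite -?opA -?Eb ?opA ?sx //; exact: NM.
  - move=> t Dt s Ds; have [x [y [/DN Nx Dy E]]] := square s t Ds Dt.
    by exists x, y.
pose P2 : set T := [set g | forall h, N h ->
  exists u v, [/\ N u, N v & op g u = op h v]].
suff NP2 : N `<=` P2 by move=> g h /NP2; exact.
apply: Nind.
- by move=> h Nh; exists h, e; rewrite opx1 op1x.
- move=> g k Pg Pk h /Pg[u [v [Nu Nv gu]]].
  have [w [z [Nw Nz kw]]] := Pk u Nu.
  exists w, (op v z); split=> //; first exact: NM.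
  by rewrite -opA kw !opA gu.
- by move=> s Ds h /NP1/(_ s Ds)[x [b [Nx /DN Nb E]]]; exists x, b.
Qed.

(** Right common multiples are what makes right fractions stable under
    products: [b^-1 * d = u * v^-1] whenever [b * u = d * v] (the Ore
    condition). *)
Lemma generated_fractions (G : groupType) (A N : set G) :
  submonoid N -> A `<=` N ->
  (forall g h, N g -> N h -> exists u v, [/\ N u, N v & g * u = h * v]) ->
  forall g, generated_subgroup A g -> exists a b, [/\ N a, N b & g = a * b^-1].
Proof.
move=> /submonoidP[N1 NM] AN cm.
apply: smallest_sub; last first.
  by move=> a /AN Na; exists a, 1; rewrite invg1 mulg1.
apply/subgroupP; split; first by exists 1, 1; rewrite invg1 mulg1.
move=> _ _ [a [b [Na Nb ->]]] [c [d [Nc Nd ->]]].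
have [u [v [Nu Nv buv]]] := cm b d Nb Nd.
exists (a * u), (c * v); split; [exact: NM|exact: NM|].
have -> : u = b^-1 * (d * v) by rewrite -buv mulKg.
by rewrite !invgM invgK !mulgA mulgK.
Qed.

End Generated.

(** * Divisibility in a submonoid of a group *)

Section Monoid.
Local Open Scope group_scope.
Context (G : groupType) (M : set G).
Hypothesis M_submonoid : submonoid M.

Let M1 : M 1. Proof. by case/submonoidP: M_submonoid. Qed.
Let MM x y : M x -> M y -> M (x * y).
Proof. by case/submonoidP: M_submonoid => _; exact. Qed.

Definition factor_closed (N : set G) : Prop :=
  forall g k, M g -> M k -> N (g * k) -> N g /\ N k.

Lemma ldivides_mul2l p a b : ldivides M (p * a) (p * b) <-> ldivides M a b.
Proof.
by split=> -[k Mk E]; exists k => //; [apply: (mulgI p)|]; rewrite ?E mulgA.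
Qed.

(** If [d = g * k * l], then [g] is a left divisor of [d], and [k] is a right
    divisor of [g * k], which is itself a right divisor of [d] as [d] is
    balanced. *)
Lemma balanced_factors d : balanced M d -> factor_closed (divisors_of M d).
Proof.
move=> [Md bal] g k Mg Mk [Mgk [l Ml dE]].
split; first by split=> //; exists (k * l); [exact: MM|rewrite dE mulgA].
have : right_divisors M d (g * k) by rewrite -bal; split=> //; exists l.
move=> [_ [l' Ml' dE']].
suff : right_divisors M d k by rewrite -bal.
by split=> //; exists (l' * g); [exact: MM|rewrite dE' mulgA].
Qed.

Lemma divisors_of1 d : M d -> divisors_of M d 1.
Proof. by move=> Md; split=> //; exists d; rewrite ?mul1g. Qed.

Lemma divisors_of_id d : M d -> divisors_of M d d.
Proof. by move=> Md; split=> //; exists 1; rewrite ?mulg1. Qed.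

Lemma lattice_conical g k :
  lattice_on M (ldivides M) -> M g -> M k -> g * k = 1 -> g = 1.
Proof.
move=> [[_ anti _] _ _] Mg Mk gk.
by apply: anti => //; [exists k|exists g; rewrite ?mul1g].
Qed.

Lemma noetherian_bound g : noetherian M -> M g ->
  exists n, forall s : seq G, (forall x, x \in s -> M x /\ x <> 1) ->
    g = \prod_(x <- s) x -> size s <= n.
Proof.
move=> noeth /noeth/finite_seqP[K EK].
exists (\max_(k <- K) k) => s Ms gE.
have : [set` K] (size s) by rewrite -EK; exists s.
by move=> /= sK; apply: leq_bigmax_seq.
Qed.

(** Otherwise [g = k ^+ n * g * l ^+ n] would have arbitrarily long
    decompositions. *)
Lemma noetherian_absorb g k l :
  noetherian M -> M g -> M k -> M l -> g = k * g * l -> k = 1.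
Proof.
move=> noeth Mg Mk Ml gE; apply: contrapT => k1.
have [n bound] := noetherian_bound noeth Mg.
have powE m : exists2 r, M r & g = k ^+ m * r.
  elim: m => [|m [r Mr Er]]; first by exists g; rewrite ?expg0 ?mul1g.
  exists (r * l); first exact: MM.
  by rewrite gE {1}Er expgS !mulgA.
have [r Mr gr] := powE n.+1.
(* A decomposition may not contain 1, so the last factor [r] is listed only
   when it is not trivial. *)
have [r1|/eqP r1] := eqVneq r 1.
  have := bound (nseq n.+1 k).
  rewrite r1 mulg1 in gr; rewrite size_nseq ltnn big_nseq iter_mulg_1 => B.
  by suff: false by []; apply: B => // x /nseqP[-> _].
have := bound (rcons (nseq n.+1 k) r).
rewrite size_rcons size_nseq big_rcons big_nseq.
rewrite iter_mulg_1 => B; suff: n.+2 <= n by rewrite ltnNge leqnSn.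
by apply: B => // x; rewrite mem_rcons inE => /orP[/eqP->|/nseqP[-> _]].
Qed.

(** Induction on a bound for the lengths of the decompositions of an element:
    the two factors of an element that is not an atom have smaller bounds. *)
Lemma noetherian_atoms : noetherian M -> M `<=` generated_submonoid (atoms M).
Proof.
move=> noeth g Mg; have [n] := noetherian_bound noeth Mg.
have /submonoidP[A1 AM] := generated_submonoidP (atoms M).
elim: n g Mg => [|n IH] g Mg bound.
  have [->//|/eqP g1] := eqVneq g 1.
  have := bound [:: g]; rewrite big_seq1 => B; suff: 1 <= 0 by [].
  by apply: B => // x; rewrite inE => /eqP->.
have [->//|/eqP g1] := eqVneq g 1.
have [gA|gA] := pselect (atoms M g); first exact: sub_gen_smallest.
have [u [v [Mu Mv gE u1 v1]]] :
    exists u v, [/\ M u, M v, g = u * v, u <> 1 & v <> 1].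
  apply: contrapT => nuv; apply: gA; split=> // u v Mu Mv gE.
  have [|/eqP u1] := eqVneq u 1; first by left.
  have [|/eqP v1] := eqVneq v 1; first by right.
  by case: nuv; exists u, v.
rewrite gE; apply: AM; apply: IH => // s Ms sE.
- rewrite -ltnS -(size_rcons s v); apply: bound.
    by move=> x; rewrite mem_rcons inE => /orP[/eqP->|/Ms].
  by rewrite big_rcons /= -sE.
- rewrite -ltnS -[X in X <= _]/(size (u :: s)); apply: bound.
    by move=> x; rewrite inE => /orP[/eqP->|/Ms].
  by rewrite big_cons /= -sE.
Qed.

(** Every atom in a decomposition of a divisor of [d] divides [d], because the
    divisors of a balanced element are closed under factors. *)
Lemma divisors_parabolic d :
  noetherian M -> balanced M d -> divisors_of M d `<=` parabolic_group M d.
Proof.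
move=> noeth bal g Dg.
have /subgroup_submonoid/submonoidP[P1 PM] := generated_subgroupP (supp M d).
have Ag := noetherian_atoms noeth Dg.1.
move: g Ag Dg; apply: generated_left_ind => // s h sA hA IH Dsh.
have Mh : M h.
  by apply: hA; split; [exact: M_submonoid|by move=> a []].
have Ms : M s by case: (sA).
have [Ds Dh] := balanced_factors bal Ms Mh Dsh.
by apply: PM; [apply: sub_gen_smallest|exact: IH].
Qed.

Lemma is_glbL_mul2l p a b d : lattice_on M (ldivides M) ->
  M p -> M a -> M b ->
  is_glb M (ldivides M) a b d ->
  is_glb M (ldivides M) (p * a) (p * b) (p * d).
Proof.
move=> [_ glb _] Mp Ma Mb [Md da db dmax].
have Mpa := MM Mp Ma; have Mpb := MM Mp Mb.
split; [exact: MM|exact/ldivides_mul2l|exact/ldivides_mul2l|].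
move=> e Me ea eb.
(* A gcd of [p * a] and [p * b] is a multiple of [p], so it can be compared with
   [p * d] after cancelling [p]. *)
have [f [Mf fa fb fmax]] := glb _ _ Mpa Mpb.
have [f' Mf' fE] : ldivides M p f by apply: fmax => //; [exists a|exists b].
have [k Mk fk] := fmax e Me ea eb.
have [l Ml ->] : ldivides M f' d.
  by apply: dmax => //; apply/(ldivides_mul2l p); rewrite -fE.
by exists (k * l); rewrite ?mulgA -?fk -?fE; first exact: MM.
Qed.

Lemma is_glbL_unique a b d d' : lattice_on M (ldivides M) ->
  is_glb M (ldivides M) a b d -> is_glb M (ldivides M) a b d' -> d = d'.
Proof.
move=> [[_ anti _] _ _] [Md da db dmax] [Md' da' db' dmax'].
by apply: anti => //; [apply: dmax'|apply: dmax].
Qed.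

(** Left translation by [g] preserves left divisibility, hence left gcds, even
    when [g] is not positive: writing [g = p^-1 * q], translate by [p] and by
    [q] instead, which keeps all the elements in [M]. *)
Lemma gcdL_fraction g a b a' b' c d :
  lattice_on M (ldivides M) -> group_of_fractions M ->
  M a -> M b -> M a' -> M b' -> a = g * b -> a' = g * b' ->
  is_glb M (ldivides M) a a' c -> is_glb M (ldivides M) b b' d ->
  c = g * d.
Proof.
move=> lat /(_ g)[p [q [Mp Mq gE]]] Ma Mb Ma' Mb' aE aE' cE dE.
have pg : p * g = q by rewrite gE mulVKg.
apply: (mulgI p); rewrite mulgA pg.
apply: (@is_glbL_unique (p * a) (p * a')) => //; first exact: is_glbL_mul2l.
by rewrite aE aE' !mulgA pg; exact: is_glbL_mul2l.
Qed.

(** Gcds, and in particular [alphaL] and [alphaR], are factors of elements of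
    [N]; so are lcms, since they divide a common multiple that lies in [N]. *)
Lemma factor_closed_garside Delta N :
  lattice_on M (ldivides M) -> lattice_on M (rdivides M) -> M Delta ->
  submonoid N -> N `<=` M -> factor_closed N ->
  (forall g h, N g -> N h -> exists u v, [/\ N u, N v & g * u = h * v]) ->
  (forall g h, N g -> N h -> exists u v, [/\ N u, N v & u * g = v * h]) ->
  garside_submonoid M Delta N.
Proof.
move=> [_ glbL lubL] [_ glbR lubR] MDelta Nsub NM Nfactor cmL cmR.
have /submonoidP[_ Nmul] := Nsub.
have Ngcd_l g h : N g -> M h -> N (gcdL M g h).
  move=> Ng Mh; rewrite /gcdL.
  have /(xgetPex 1)[Md [k Mk gE] _ _] := glbL g h (NM _ Ng) Mh.
  by rewrite gE in Ng; have [] := Nfactor _ _ Md Mk Ng.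
have Ngcd_r g h : N g -> M h -> N (gcdR M g h).
  move=> Ng Mh; rewrite /gcdR.
  have /(xgetPex 1)[Md [k Mk gE] _ _] := glbR g h (NM _ Ng) Mh.
  by rewrite gE in Ng; have [] := Nfactor _ _ Mk Md Ng.
split=> //.
- by move=> g h Ng Nh; apply: Ngcd_l => //; exact: NM.
- move=> g h Ng Nh; rewrite /lcmL.
  have [u [v [Nu Nv E]]] := cmL g h Ng Nh.
  have /(xgetPex 1)[Mm _ _ mmin] := lubL g h (NM _ Ng) (NM _ Nh).
  have [|||k Mk mE] := mmin (g * u).
  + exact: MM (NM _ Ng) (NM _ Nu).
  + by exists u => //; exact: NM.
  + by exists v => //; exact: NM.
  by apply: (Nfactor _ _ Mm Mk _).1; rewrite -mE; exact: Nmul.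
- by move=> g h Ng Nh; apply: Ngcd_r => //; exact: NM.
- move=> g h Ng Nh; rewrite /lcmR.
  have [u [v [Nu Nv E]]] := cmR g h Ng Nh.
  have /(xgetPex 1)[Mm _ _ mmin] := lubR g h (NM _ Ng) (NM _ Nh).
  have [|||k Mk mE] := mmin (u * g).
  + exact: MM (NM _ Nu) (NM _ Ng).
  + by exists u => //; exact: NM.
  + by exists v => //; exact: NM.
  by apply: (Nfactor _ _ Mk Mm _).2; rewrite -mE; exact: Nmul.
- by move=> _ [w Nw <-]; exact: Ngcd_l.
- by move=> _ [w Nw <-]; exact: Ngcd_r.
Qed.

End Monoid.

(** * Standard parabolic subgroups *)

Section Garside.
Local Open Scope group_scope.
Context (G : groupType) (X : set G) (Delta : G).
Let M := generated_submonoid X.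
Hypotheses (hX : garside_system X) (hDelta : garside_element M X Delta).

Let M_submonoid : submonoid M. Proof. exact: generated_submonoidP. Qed.
Let M1 : M 1. Proof. by case/submonoidP: M_submonoid. Qed.
Let MM x y : M x -> M y -> M (x * y).
Proof. by case/submonoidP: M_submonoid => _; exact. Qed.
Let latL : lattice_on M (ldivides M). Proof. by case: hX => -[]. Qed.
Let latR : lattice_on M (rdivides M). Proof. by case: hX => -[]. Qed.
Let noeth : noetherian M. Proof. by case: hX => -[]. Qed.
Let frac : group_of_fractions M. Proof. by case: hX. Qed.
Let balDelta : balanced M Delta. Proof. by case: hDelta. Qed.
Let XE : X = divisors_of M Delta. Proof. by case: hDelta. Qed.

Section Parabolic.
Variable d : G.
Hypothesis bal_d : balanced M d.
Hypothesis parabolic_d :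
  divisors_of M d = divisors_of M Delta `&` parabolic_monoid M d.

Let D := divisors_of M d.
Let N := generated_submonoid D.
Let N_submonoid : submonoid N. Proof. exact: generated_submonoidP. Qed.
Let N1 : N 1. Proof. by case/submonoidP: N_submonoid. Qed.
Let NM x y : N x -> N y -> N (x * y).
Proof. by case/submonoidP: N_submonoid => _; exact. Qed.

Let N_parabolic : N `<=` parabolic_monoid M d.
Proof.
apply: smallest_sub; last by rewrite /D parabolic_d => x [].
by apply: submonoidI => //; apply/subgroup_submonoid/generated_subgroupP.
Qed.

Let N_sub_M : N `<=` M. Proof. by move=> x /N_parabolic[]. Qed.

(** The heart of the proof: divisibility of [h] by a divisor of [Delta] is
    detected inside [N].  The quotient has to be in [N] as well for the
    induction to proceed. *)
Lemma simple_divisor h x : N h -> divisors_of M Delta x -> ldivides M x h ->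
  D x /\ exists2 h', N h' & h = x * h'.
Proof.
move=> Nh; move: h Nh x; apply: generated_left_ind.
  move=> x [Mx _] [k Mk kE].
  have -> : x = 1 by apply: (lattice_conical M_submonoid latL Mx Mk).
  by split; [exact: divisors_of1 bal_d.1|exists 1; rewrite ?mulg1].
move=> s h Ds Nh IH x Dx [k Mk xkE].
have Ns : N s by exact: sub_gen_smallest.
have [[Ms Mh] Mx] := ((N_sub_M Ns, N_sub_M Nh), Dx.1).
have Ds' : divisors_of M Delta s by move: Ds; rewrite /D parabolic_d => -[].
have [_ _ /(_ s x Ms Mx)[m [Mm [y My mE] [z Mz mE'] mmin]]] := latL.
have Dm : divisors_of M Delta m.
  by split=> //; apply: mmin; [exact: balDelta.1|exact: Ds'.2|exact: Dx.2].
rewrite mE in Dm; have [_ Dy] := balanced_factors M_submonoid balDelta Ms My Dm.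
have yh : ldivides M y h.
  apply/(ldivides_mul2l M s); rewrite -mE; apply: mmin; first exact: MM.
    by exists h.
  by exists k.
have [Ddy [h' Nh' hE]] := IH y Dy yh.
(* This is where the hypothesis that makes [G_d] parabolic is decisive: being a
   product [s * y] of divisors of [d] puts [m] in [N] only. *)
have Ddm : D m.
  rewrite /D parabolic_d mE; split=> //; apply: N_parabolic.
  by apply: NM => //; exact: sub_gen_smallest.
rewrite mE' in Ddm.
have [Ddx Ddz] := balanced_factors M_submonoid bal_d Mx Mz Ddm.
split=> //; exists (z * h'); first by apply: NM => //; exact: sub_gen_smallest.
by rewrite hE mulgA -mE mE' mulgA.
Qed.

Lemma generated_divisors_factor_closed : factor_closed M N.
Proof.
move=> g k Mg; move: g Mg k; apply: generated_left_ind => [k _|].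
  by rewrite mul1g.
move=> s h Xs Mh IH k Mk; rewrite -mulgA => Nshk.
have Ds : divisors_of M Delta s by rewrite -XE.
have shk : ldivides M s (s * (h * k)) by exists (h * k) => //; exact: MM.
have [Dds [r Nr /mulgI hkE]] := simple_divisor Nshk Ds shk.
rewrite -hkE in Nr; have [Nh Nk] := IH k Mk Nr.
by split=> //; apply: NM => //; exact: sub_gen_smallest.
Qed.

Let N_common_right g h : N g -> N h ->
  exists u v, [/\ N u, N v & g * u = h * v].
Proof.
apply: (@common_multiples _ 1 *%g D); rewrite /left_id /right_id //.
- exact: mulgA.
- exact: mul1g.
- exact: mulg1.
- exact: sub_gen_smallest.
- by move=> P P1 PM DP; apply: smallest_sub => //; apply/submonoidP.
have Dd : D d by exact: divisors_of_id bal_d.1.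
move=> s t [Ms [x Mx sx]] [Mt [y My ty]].
exists x, y; split; last by rewrite -sx.
- by apply: (balanced_factors M_submonoid bal_d Ms Mx _).2; rewrite -sx.
- by apply: (balanced_factors M_submonoid bal_d Mt My _).2; rewrite -ty.
Qed.

Let N_common_left g h : N g -> N h ->
  exists u v, [/\ N u, N v & u * g = v * h].
Proof.
apply: (@common_multiples _ 1 (fun x y => y * x) D).
- by move=> x y z; rewrite mulgA.
- exact: mulg1.
- exact: mul1g.
- exact: N1.
- by move=> x y Nx Ny; exact: NM.
- exact: sub_gen_smallest.
- move=> P P1 PM DP; apply: smallest_sub => //; apply/submonoidP.
  by split=> // x y Px Py; exact: PM.
have Dd : D d by exact: divisors_of_id bal_d.1.
have Dright s : D s -> right_divisors M d s by rewrite -bal_d.2.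
move=> s t /Dright[Ms [x Mx sx]] /Dright[Mt [y My ty]].
exists x, y; split; last by rewrite -sx.
- by apply: (balanced_factors M_submonoid bal_d Mx Ms _).1; rewrite -sx.
- by apply: (balanced_factors M_submonoid bal_d My Mt _).1; rewrite -ty.
Qed.

Let parabolic_frac g : parabolic_group M d g ->
  exists a b, [/\ N a, N b & g = a * b^-1].
Proof.
apply: generated_fractions => //.
by move=> x [Dx _]; exact: sub_gen_smallest.
Qed.

(** An element of [G_d] is a fraction [a * b^-1] over [N]; when it is in [M] it
    is a factor of [a]. *)
Lemma parabolic_monoid_generated : parabolic_monoid M d = N.
Proof.
apply/seteqP; split=> // g [/parabolic_frac[a [b [Na Nb gE]]] Mg].
have aE : a = g * b by rewrite gE mulgVK.
rewrite aE in Na.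
by have [] := generated_divisors_factor_closed Mg (N_sub_M Nb) Na.
Qed.

Lemma parabolic_factor_closed : factor_closed M (parabolic_monoid M d).
Proof.
by rewrite parabolic_monoid_generated; exact: generated_divisors_factor_closed.
Qed.

Lemma parabolic_fractions g : parabolic_group M d g ->
  exists a b,
    [/\ parabolic_monoid M d a, parabolic_monoid M d b & g = a * b^-1].
Proof. by move=> /parabolic_frac; rewrite parabolic_monoid_generated. Qed.

Lemma parabolic_garside : garside_subgroup M Delta (parabolic_group M d).
Proof.
split; first exact: generated_subgroupP.
  rewrite -/(parabolic_monoid M d) parabolic_monoid_generated.
  apply: factor_closed_garside => //; first exact: balDelta.1.
  exact: generated_divisors_factor_closed.
apply/seteqP; split.
  by apply: smallest_sub; [exact: generated_subgroupP|exact: subIsetl].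
apply: smallest_sub; first exact: generated_subgroupP.
move=> x sx; apply: sub_gen_smallest; split; first exact: sub_gen_smallest.
by case: sx => -[].
Qed.

End Parabolic.

(** The left gcd [e] has [D d /\ D d'] as its left divisors, and the right gcd
    [f] has the same set as its right divisors.  So [f = k * e] and [e = f * l],
    and Noetherianity forces [e = f]. *)
Lemma balanced_meet d d' : balanced M d -> balanced M d' ->
  exists2 e, balanced M e &
    divisors_of M e = divisors_of M d `&` divisors_of M d'.
Proof.
move=> bal bal'; have [Md Md'] := (bal.1, bal'.1).
have [_ /(_ d d' Md Md')[e [Me ed ed' emax]] _] := latL.
have [_ /(_ d d' Md Md')[f [Mf fd fd' fmax]] _] := latR.
have LE : left_divisors M e = divisors_of M d `&` divisors_of M d'.
  apply/seteqP; split=> [g [Mg [k Mk eE]]|g [[Mg gd] [_ gd']]].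
    have De : divisors_of M d (g * k) by rewrite -eE.
    have De' : divisors_of M d' (g * k) by rewrite -eE.
    by split; [case: (balanced_factors M_submonoid bal Mg Mk De)
              |case: (balanced_factors M_submonoid bal' Mg Mk De')].
  by split=> //; exact: emax.
have RE : right_divisors M f = divisors_of M d `&` divisors_of M d'.
  rewrite /divisors_of bal.2 bal'.2.
  apply/seteqP; split=> [g [Mg [k Mk fE]]|g [[Mg gd] [_ gd']]].
    rewrite -bal.2 -bal'.2.
    have Df : divisors_of M d (k * g) by rewrite /divisors_of bal.2 -fE.
    have Df' : divisors_of M d' (k * g) by rewrite /divisors_of bal'.2 -fE.
    by split; [case: (balanced_factors M_submonoid bal Mk Mg Df)
              |case: (balanced_factors M_submonoid bal' Mk Mg Df')].
  by split=> //; exact: fmax.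
have [_ [k Mk fE]] : right_divisors M f e.
  by rewrite RE -LE; exact: divisors_of_id.
have [_ [l Ml eE]] : left_divisors M e f.
  by rewrite LE -RE; split=> //; exists 1; rewrite ?mul1g.
have k1 : k = 1.
  by apply: (noetherian_absorb M_submonoid noeth Me Mk Ml); rewrite -fE.
have feE : f = e by rewrite fE k1 mul1g.
by exists e => //; split=> //; rewrite -feE RE feE.
Qed.

Lemma standard_parabolicI P Q : standard_parabolic M Delta P ->
  standard_parabolic M Delta Q -> standard_parabolic M Delta (P `&` Q).
Proof.
move=> [d [bal dD dpar ->]] [d' [bal' dD' dpar' ->]].
have [e bale eE] := balanced_meet bal bal'.
have Me := bale.1.
have eD : divisors_of M Delta e.
  have : divisors_of M e e by exact: divisors_of_id.
  by rewrite eE dpar => -[[]].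
have sub : parabolic_group M e `<=`
    parabolic_group M d `&` parabolic_group M d'.
  apply: smallest_sub; first by apply: subgroupI; exact: generated_subgroupP.
  move=> x [xe xA]; rewrite eE in xe.
  by split; apply: sub_gen_smallest; split=> //; [exact: xe.1|exact: xe.2].
have De_sub : divisors_of M e `<=` parabolic_group M e.
  exact: divisors_parabolic.
have subM : parabolic_monoid M d `&` parabolic_monoid M d' `<=`
    parabolic_group M e.
  have /subgroup_submonoid/submonoidP[E1 EM] := generated_subgroupP (supp M e).
  move=> g gN; have Mg : M g by case: gN => -[].
  move: g Mg gN; apply: generated_left_ind => // s h Xs Mh IH [Nsh Nsh'].
  have Ms : M s by exact: sub_gen_smallest.
  have [Ns Nh] := parabolic_factor_closed bal dpar Ms Mh Nsh.
  have [Ns' Nh'] := parabolic_factor_closed bal' dpar' Ms Mh Nsh'.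
  apply: EM; last exact: IH.
  by apply: De_sub; rewrite eE dpar dpar' -XE.
exists e; split=> //.
- rewrite eE; apply/seteqP; split=> g.
    move=> gdd'; have ge : divisors_of M e g by rewrite eE.
    split; first by move: gdd'.1; rewrite dpar => -[].
    by split; [exact: De_sub|exact: ge.1].
  move=> [gD [/sub[gd gd'] Mg]].
  by rewrite dpar dpar'.
- apply/seteqP; split=> // g [].
  move=> /(parabolic_fractions bal dpar)[a [b [Na Nb gE]]].
  move=> /(parabolic_fractions bal' dpar')[a' [b' [Na' Nb' gE']]].
  have [[Ma Mb] [Ma' Mb']] := ((Na.2, Nb.2), (Na'.2, Nb'.2)).
  have [_ glb _] := latL.
  have [x xE] := glb a a' Ma Ma'; have [y yE] := glb b b' Mb Mb'.
  have xgy : x = g * y.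
    apply: (gcdL_fraction M_submonoid latL frac Ma Mb Ma' Mb' _ _ xE yE).
      by rewrite gE mulgVK.
    by rewrite gE' mulgVK.
  have meet u v w : parabolic_monoid M d u -> parabolic_monoid M d' v ->
      is_glb M (ldivides M) u v w -> parabolic_group M e w.
    move=> Nu Nv [Mw [k Mk uE] [l Ml vE] _]; rewrite uE in Nu; rewrite vE in Nv.
    apply: subM; split.
      by case: (parabolic_factor_closed bal dpar Mw Mk Nu).
    by case: (parabolic_factor_closed bal' dpar' Mw Ml Nv).
  have -> : g = x * y^-1 by rewrite xgy mulgK.
  have /subgroupP[_] := generated_subgroupP (supp M e); apply.
    exact: meet xE.
  exact: meet yE.
Qed.

End Garside.

Theorem proposition3 (G : groupType) (X : set G) (Delta : G)
  (hX : garside_system X)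
  (hDelta : garside_element (generated_submonoid X) X Delta)
  (hfin : finite_set X) :
  (forall P : set G,
     standard_parabolic (generated_submonoid X) Delta P ->
     garside_subgroup (generated_submonoid X) Delta P)
  /\
  (forall P Q : set G,
     standard_parabolic (generated_submonoid X) Delta P ->
     standard_parabolic (generated_submonoid X) Delta Q ->
     standard_parabolic (generated_submonoid X) Delta (P `&` Q)).
Proof.
split=> [P [d [bal dD dpar ->]]|P Q].
  exact: (parabolic_garside hX hDelta bal dpar).
exact: standard_parabolicI.
Qed.
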